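(* Let $n\ge 2$ be an integer. Let $\mathfrak{A}$ and $\mathfrak{A}'$ be two $C^*$-algebras with identities $I_{\mathfrak{A}}$ and $I_{\mathfrak{A}'}$, respectively, and let $P_1$ and $P_2=I_{\mathfrak{A}}-P_1$ be nontrivial projections in $\mathfrak{A}$. Suppose that $\mathfrak{A}$ satisfies: for each $i\in\{1,2\}$ and each $X\in\mathfrak{A}$, $X\mathfrak{A}P_i=\{0\}$ implies $X=0$. Suppose moreover that $\varphi:\mathfrak{A}\to\mathfrak{A}'$ is a bijective unital map (not assumed additive) which satisfies $$\varphi(q_{n*}(I_{\mathfrak{A}},\dots,I_{\mathfrak{A}},A,B))=q_{n*}(\varphi(I_{\mathfrak{A}}),\dots,\varphi(I_{\mathfrak{A}}),\varphi(A),\varphi(B))$$ and $$\varphi(q_{n*}(P,\dots,P,A,B))=q_{n*}(\varphi(P),\dots,\varphi(P),\varphi(A),\varphi(B))$$ for all $A,B\in\mathfrak{A}$ and $P\in\{P_1,P_2\}$. Then $\varphi$ is $*$-additive, i.e. $\varphi(A+B)=\varphi(A)+\varphi(B)$ and $\varphi(A^* )=\varphi(A)^*$ for all $A,B\in\mathfrak{A}$.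
   Context: $C^*$-algebras are complex. For elements $A,B$ of a $*$-ring, $\{A,B\}_*:=AB+BA^*$ (the $*$-Jordan product). Define $q_{1*}(x)=x$ and $q_{n*}(x_1,\dots,x_n)=\{q_{(n-1)*}(x_1,\dots,x_{n-1}),x_n\}_*$ for $n\ge 2$. In $q_{n*}(T,\dots,T,A,B)$ the element $T$ appears $n-2$ times (so for $n=2$ the expression is $q_{2*}(A,B)$). A projection is a self-adjoint idempotent; it is nontrivial if it is neither $0$ nor the identity. Unital means $\varphi(I_{\mathfrak{A}})=I_{\mathfrak{A}'}$. *)

(* Defs.v *)
From HB Require Import structures.
From mathcomp Require Import all_boot all_order all_algebra.
From mathcomp Require Import reals.
From mathcomp Require Import complex.

Set Implicit Arguments.
Unset Strict Implicit.
Unset Printing Implicit Defensive.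
Import Order.TTheory GRing.Theory Num.Theory.

Local Open Scope ring_scope.
Local Open Scope complex_scope.

(* Unital complex C*-algebras.  The norm is a field of the mixin, and not the
   one of a normedModType, because Hierarchy Builder admits no structure that
   inherits both a ring and a normed Z-module other than below numDomainType. *)
HB.mixin Record isCStarAlgebra (R : realType) A & GRing.Algebra R[i] A := {
  star : A -> A ;
  starK : involutive star ;
  starD : {morph star : x y / x + y} ;
  starZ : forall (a : R[i]) (x : A), star (a *: x) = a^* *: star x ;
  starM : forall x y : A, star (x * y) = star y * star x ;
  cstar_norm : A -> R ;
  cstar_norm_eq0 : forall x : A, cstar_norm x = 0 -> x = 0 ;
  cstar_normD : forall x y : A,
    cstar_norm (x + y) <= cstar_norm x + cstar_norm y ;
  cstar_normZ : forall (a : R[i]) (x : A),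
    (cstar_norm (a *: x))%:C = `|a| * (cstar_norm x)%:C ;
  cstar_normM : forall x y : A,
    cstar_norm (x * y) <= cstar_norm x * cstar_norm y ;
  cstar_identity : forall x : A, cstar_norm (star x * x) = cstar_norm x ^+ 2 ;
  cstar_complete : forall u : nat -> A,
    (forall e : R, 0 < e -> exists N : nat, forall m n : nat,
       (N <= m)%N -> (N <= n)%N -> cstar_norm (u m - u n) < e) ->
    exists l : A, forall e : R, 0 < e -> exists N : nat, forall n : nat,
       (N <= n)%N -> cstar_norm (u n - l) < e }.

#[short(type="cstarAlgType")]
HB.structure Definition CStarAlgebra (R : realType) :=
  { A of GRing.Algebra R[i] A & isCStarAlgebra R A }.

Section StarJordan.
Variables (R : realType) (A : cstarAlgType R).
Implicit Types (x y : A) (s : seq A).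

Definition jstar x y : A := x * y + y * star x.

(* q_{n*}(x_1, ..., x_n) is [qstar [:: x_1; ...; x_n]], the index n being the
   size of the sequence; the value at the empty sequence is a dummy. *)
Definition qstar s : A := if s is x :: s' then foldl jstar x s' else 0.

Lemma qstar1 x : qstar [:: x] = x.
Proof. by []. Qed.

Lemma qstar_rcons s y : (0 < size s)%N -> qstar (rcons s y) = jstar (qstar s) y.
Proof. by case: s => // x s _; rewrite /= -cats1 foldl_cat. Qed.

Definition projection x : Prop := star x = x /\ x * x = x.

Definition nontrivial_projection x : Prop :=
  [/\ projection x, x <> 0 & x <> 1].

End StarJordan.

(* Main.v *)
From HB Require Import structures.
Require Import Defs.
From mathcomp Require Import all_boot all_order all_algebra.
From mathcomp Require Import reals.
From mathcomp Require Import complex.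
Set Implicit Arguments.
Unset Strict Implicit.
Unset Printing Implicit Defensive.
Import GRing.Theory.
Local Open Scope ring_scope.

(** Write [x o y] for [jstar x y], that is x y + y x^*.  Evaluating the
    leading identities turns the condition at the identity into the single law
    [phi (r (x o y)) = r (phi x o phi y)] with the nonzero scalar r = 2^(n-2)
    ([qstar_nseq1]), and this law alone forces additivity.

    The product [o] is biadditive.  Hence, if t is chosen by surjectivity with
    phi t = phi a + phi b, multiplying by any x gives
    phi (r (x o t)) = phi (r (x o a)) + phi (r (x o b)), and likewise on the
    other side.  Whenever the right-hand side is already known to be
    phi (r (x o (a + b))), injectivity yields x o (t - (a + b)) = 0.  Enough
    such tests x force t = a + b, so that phi is additive at (a, b)
    ([additive_at_tests]).  Since phi 0 = 0, a test is always available when it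
    annihilates a or b; every pair settled in this way supplies new tests.

    With P = P1 and Q = P2, the tests P and Q separate the diagonal corners PAP
    and QAQ ([additive_at_diag]).  Opposite off-diagonal corners PAQ and QAP are both
    annihilated by P - Q, and the tests c in PAQ send them into opposite diagonal
    corners ([additive_at_offdiag]).  A diagonal and an off-diagonal element are
    separated by P - Q, which kills the second, and by iP, which kills the first
    ([additive_at_diag_offdiag]); here the complex scalars matter.  So phi is
    additive along the Peirce decomposition ([phi_peirce]).

    Inside PAQ, the product (P + a) o (Q + b) = a + b + a^* + b a^* has a + b
    as its PAQ component, while its image under phi can also be
    expanded into the images of the four partial products; comparing the two
    gives phi (r (a + b)) = phi (r a) + phi (r b)
    ([additive_at_corner_offdiag]).  Inside PAP, tests c in PAQ reduce the
    question to PAQ, and the faithfulness hypothesis allows c to be cancelled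
    ([additive_at_corner_diag]).  Finally x o 1 = x + x^* turns additivity into
    preservation of the involution ([phi_star]). *)

(** * The star-Jordan product *)

Section StarJordanTheory.
Variables (R : realType) (A : cstarAlgType R).
Implicit Types (x y z : A).

Lemma star_is_nmod : nmod_morphism (@star R A).
Proof.
split; last exact: starD.
by apply: (addrI (star (0 : A))); rewrite -starD !addr0.
Qed.

HB.instance Definition _ :=
  GRing.isNmodMorphism.Build A A (@star R A) star_is_nmod.

Lemma star1 : star (1 : A) = 1.
Proof. by rewrite -[LHS]mulr1 -[X in _ * X](starK 1) -starM mulr1 starK. Qed.

Lemma jstarDl x y z : jstar (x + y) z = jstar x z + jstar y z.
Proof. by rewrite /jstar raddfD mulrDl mulrDr addrACA. Qed.

Lemma jstarDr x y z : jstar x (y + z) = jstar x y + jstar x z.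
Proof. by rewrite /jstar mulrDl mulrDr addrACA. Qed.

Lemma jstarNl x y : jstar (- x) y = - jstar x y.
Proof. by rewrite /jstar raddfN mulrN mulNr opprD. Qed.

Lemma jstarNr x y : jstar x (- y) = - jstar x y.
Proof. by rewrite /jstar mulrN mulNr opprD. Qed.

Lemma jstar0l x : jstar 0 x = 0.
Proof. by rewrite /jstar raddf0 mul0r mulr0 addr0. Qed.

Lemma jstar0r x : jstar x 0 = 0.
Proof. by rewrite /jstar mul0r mulr0 addr0. Qed.

Lemma jstarMnl x y m : jstar (x *+ m) y = jstar x y *+ m.
Proof. by rewrite /jstar raddfMn mulrnAl mulrnAr mulrnDl. Qed.

Lemma jstar1l x : jstar 1 x = x *+ 2.
Proof. by rewrite /jstar star1 mul1r mulr1. Qed.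

Lemma jstar1r x : jstar x 1 = x + star x.
Proof. by rewrite /jstar mul1r mulr1. Qed.

(** Left multiplication by the identity doubles, and each of the [k] leading
    identities causes one doubling: [k - 1] of them among themselves and one
    when [x] is reached. *)
Lemma qstar_nseq1 k x y :
  qstar (nseq k 1 ++ [:: x; y]) = (2 ^ k)%:R *: jstar x y.
Proof.
rewrite scaler_nat; case: k => [|k] //=.
have fold1 m z : star z = z -> foldl (@jstar R A) z (nseq m 1) = z *+ 2 ^ m.
  elim: m z => [|m IHm] z zz //=.
  by rewrite IHm jstar1r zz ?raddfD /= ?zz // -mulr2n -mulrnA expnS.
by rewrite foldl_cat fold1 ?star1 //= !jstarMnl jstar1l jstarMnl -mulrnA expnS.
Qed.

Lemma mulrn2_eq0 x : x + x = 0 -> x = 0.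
Proof.
move=> /eqP; rewrite -mulr2n -scaler_nat scaler_eq0 Num.Theory.pnatr_eq0 /=.
by move/eqP.
Qed.

End StarJordanTheory.

(** * Peirce corners *)

Section Corners.
Variables (R : realType) (A : cstarAlgType R).
Implicit Types (p q s x y w : A).

Definition corner p q x : Prop := p * x = x /\ x * q = x.

Definition faithful p : Prop :=
  forall x, (forall y, x * y * p = 0) -> x = 0.

Record peirce p q : Prop := Peirce {
  peirce_projl : projection p;
  peirce_projr : projection q;
  peirce_orthl : p * q = 0;
  peirce_orthr : q * p = 0;
  peirce_add : p + q = 1;
  peirce_faithl : faithful p;
  peirce_faithr : faithful q }.

Lemma peirce_sym p q : peirce p q -> peirce q p.
Proof. by case=> *; split=> //; rewrite addrC. Qed.

Lemma cornerD p q x y : corner p q x -> corner p q y -> corner p q (x + y).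
Proof.
by case=> px xq [py yq]; split; rewrite (mulrDr, mulrDl) ?px ?py ?xq ?yq.
Qed.

Lemma cornerZ p q (c : R[i]%C) x : corner p q x -> corner p q (c *: x).
Proof. by case=> px xq; split; rewrite -?scalerAr -?scalerAl ?px ?xq. Qed.

Lemma cornerM p q s x y : corner p q x -> corner q s y -> corner p s (x * y).
Proof. by case=> px _ [_ ys]; split; rewrite -?mulrA ?ys // mulrA px. Qed.

Lemma corner_star p q x :
  star p = p -> star q = q -> corner p q x -> corner q p (star x).
Proof. by move=> pp qq [px xq]; split; rewrite -{1}(pp, qq) -starM ?px ?xq. Qed.

Lemma corner_mid p q x : p * p = p -> q * q = q -> corner p q (p * x * q).
Proof. by move=> pp qq; split; rewrite ?mulrA ?pp // -mulrA qq. Qed.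

Lemma corner_projection p : projection p -> corner p p p.
Proof. by case. Qed.

Lemma corner_ortho p q p' q' x y :
  q * p' = 0 -> corner p q x -> corner p' q' y -> x * y = 0.
Proof. by move=> o [_ <-] [<- _]; rewrite mulrA -(mulrA x) o mulr0 mul0r. Qed.

End Corners.

(** * Additivity from the star-Jordan law *)

Section Additivity.
Variables (R : realType) (A A' : cstarAlgType R) (phi : A -> A') (r : R[i]%C).
Hypotheses (phi_bij : bijective phi) (r_neq0 : r != 0).
Hypothesis phi_jstar :
  forall x y, phi (r *: jstar x y) = r *: jstar (phi x) (phi y).
Implicit Types (P Q a b c d o w x y : A).

Definition additive_at a b : Prop := phi (a + b) = phi a + phi b.

(** Any [x] with [phi x = 0] serves here, as [x o 0 = 0] while
    [phi x o phi 0 = 0]. *)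
Lemma phi0 : phi 0 = 0.
Proof.
have [psi _ psiK] := phi_bij.
by have := phi_jstar (psi 0) 0; rewrite psiK jstar0r jstar0l !scaler0.
Qed.

Lemma additive_at0l x : additive_at 0 x.
Proof. by rewrite /additive_at phi0 !add0r. Qed.

Lemma additive_at0r x : additive_at x 0.
Proof. by rewrite /additive_at phi0 !addr0. Qed.

(** The element [w] stands for [t - (a + b)], where [phi t = phi a + phi b]:
    biadditivity transports this relation to all products with a fixed element
    [x], and injectivity of [phi] applies as soon as [phi] is additive at the
    two products. *)
Lemma additive_at_tests a b :
  (forall w,
     (forall x, additive_at (r *: jstar x a) (r *: jstar x b) ->
        jstar x w = 0) ->
     (forall x, additive_at (r *: jstar a x) (r *: jstar b x) ->
        jstar w x = 0) ->
     w = 0) ->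
  additive_at a b.
Proof.
move=> test; have [psi phiK psiK] := phi_bij.
pose t := psi (phi a + phi b).
have phit : phi t = phi a + phi b by rewrite psiK.
suff /subr0_eq eq_t : t - (a + b) = 0 by rewrite /additive_at -eq_t.
have cancel u v : phi (r *: u) = phi (r *: v) -> u - v = 0.
  by move/(can_inj phiK)/(scalerI r_neq0)->; rewrite subrr.
apply: test => x add.
  rewrite jstarDr jstarNr; apply: cancel.
  by rewrite phi_jstar phit !jstarDr !(scalerDr _ (jstar _ _)) -!phi_jstar -add.
rewrite jstarDl jstarNl; apply: cancel.
by rewrite phi_jstar phit !jstarDl !(scalerDr _ (jstar _ _)) -!phi_jstar -add.
Qed.

Lemma jstar_projection P x : projection P -> jstar P x = P * x + x * P.
Proof. by case=> sP _; rewrite /jstar sP. Qed.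

(** The involution conjugates the scalar, so that an imaginary multiple of a
    projection yields a commutator instead of an anticommutator. *)
Lemma jstar_imaginary P x :
  projection P -> jstar ('i%C *: P) x = 'i%C *: (P * x - x * P).
Proof.
case=> sP _; rewrite /jstar starZ sP -scalerAl -scalerAr scalerBr.
congr (_ + _); rewrite -scaleNr; congr (_ *: _).
by apply/eqP; rewrite eq_complex /= oppr0 !eqxx.
Qed.

Lemma imaginary_neq0 : 'i%C != 0 :> R[i]%C.
Proof. by rewrite eq_complex /= oner_eq0 andbF. Qed.

(** The symmetry [P - Q] doubles diagonal elements up to sign and annihilates
    the off-diagonal ones, which are those with [P x + x P = x]. *)
Lemma jstar_reflection P Q x : peirce P Q ->
  jstar (P - Q) x = (P * x + x * P - x) *+ 2.
Proof.
case=> pP pQ _ _ PQ1 _ _; rewrite jstarDl jstarNl !jstar_projection //.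
have -> : Q = 1 - P by rewrite -PQ1 addrC addKr.
rewrite mulrBl mulrBr mul1r mulr1 mulr2n.
by rewrite [x - _ + _]addrACA -opprD opprB addrA [RHS]addrACA -opprD.
Qed.

(** The test [P] annihilates [b] and the test [Q] annihilates [a]; as
    [P + Q = 1], the two resulting equations add up to [w + w = 0]. *)
Lemma additive_at_diag P Q a b :
  peirce P Q -> corner P P a -> corner Q Q b -> additive_at a b.
Proof.
move=> pq ca cb; have [pP pQ PQ QP PQ1 _ _] := pq.
have [cP cQ] := (corner_projection pP, corner_projection pQ).
apply: additive_at_tests => w lw _.
have Pw : P * w + w * P = 0.
  rewrite -jstar_projection // lw // !jstar_projection //.
  rewrite (corner_ortho PQ cP cb).
  by rewrite [b * P](corner_ortho QP cb cP) addr0 scaler0; apply: additive_at0r.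
have Qw : Q * w + w * Q = 0.
  rewrite -jstar_projection // lw // !jstar_projection //.
  rewrite (corner_ortho QP cQ ca).
  by rewrite [a * Q](corner_ortho PQ ca cQ) addr0 scaler0; apply: additive_at0l.
apply: mulrn2_eq0; rewrite -{1}[w]mul1r -[X in _ + X]mulr1 -PQ1 mulrDl mulrDr.
by rewrite addrACA Pw Qw addr0.
Qed.

(** For [c] in the corner, [w c] and [c w^*] have different supports: multiplying
    [w c + c w^* = 0] by [Q] on the left isolates [Q w c], multiplying it by [P]
    on the right isolates [c w^* P].  Faithfulness cancels [c] in both. *)
Lemma corner_jstar_eq0 P Q w : peirce P Q ->
  (forall c, corner P Q c -> jstar w c = 0) -> Q * w * P = 0 /\ P * w * Q = 0.
Proof.
case=> [[sP PP] [sQ QQ]] PQ QP _ fP fQ wc.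
split; [apply: fQ => y | apply: fP => y].
  have /wc/(congr1 ( *%R Q)) := corner_mid y PP QQ.
  by rewrite /jstar mulrDr !mulrA QP !mul0r addr0 mulr0.
have /wc/(congr1 ( *%R^~ P)) := corner_mid (star y) PP QQ.
rewrite /jstar mulrDl -!mulrA QP !mulr0 add0r mul0r => /(congr1 (@star R A)).
by rewrite !starM starK raddf0 sP sQ !starK -!mulrA.
Qed.

(** Products by combinations of [P] and [Q] only rescale [a] and [b], so the
    elements [c] of PAQ are used instead, on the right: they send [a] into PAP
    and [b] into QAQ, where additivity is known.  This controls the
    off-diagonal part of [w]; the reflection [P - Q] controls the diagonal
    part. *)
Lemma additive_at_offdiag P Q a b :
  peirce P Q -> corner P Q a -> corner Q P b -> additive_at a b.
Proof.
move=> pq ca cb; have [pP pQ PQ QP PQ1 _ _] := pq.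
have [[sP PP] [sQ QQ]] := (pP, pQ).
apply: additive_at_tests => w lw rw.
have Pw : P * w + w * P = w.
  apply/subr0_eq/mulrn2_eq0; rewrite -mulr2n -(jstar_reflection _ pq) lw //.
  rewrite !(jstar_reflection _ pq).
  have [[Pa _] [_ bP]] := (ca, cb).
  have -> : a * P = 0 by apply: corner_ortho QP ca (corner_projection pP).
  by rewrite Pa addr0 subrr mul0rn scaler0; apply: additive_at0l.
have [QwP PwQ] : Q * w * P = 0 /\ P * w * Q = 0.
  apply: (corner_jstar_eq0 pq) => c cc; apply: rw.
  have csa := corner_star sP sQ ca; have csb := corner_star sQ sP cb.
  rewrite /jstar (corner_ortho QP ca cc) (corner_ortho QP cc csb) add0r addr0.
  apply: (additive_at_diag pq); apply: cornerZ; first exact: cornerM cc csa.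
  exact: cornerM cb cc.
have Qw : Q * w = 0 by rewrite -Pw mulrDr !mulrA QP mul0r add0r.
have wQ : w * Q = 0 by rewrite -Pw mulrDl -!mulrA PQ mulr0 addr0 mulrA.
have PwE : P * w = w by rewrite -{2}[w]mul1r -PQ1 mulrDl Qw addr0.
have wPE : w * P = w by rewrite -{2}[w]mulr1 -PQ1 mulrDr wQ addr0.
by move: Pw; rewrite PwE wPE => /(canRL (addrK w)); rewrite subrr.
Qed.

(** The hypotheses say that [d] is diagonal and [o] off-diagonal.  The reflection
    annihilates [o] and the imaginary multiple of [P] annihilates [d], so [w] is
    both diagonal and off-diagonal. *)
Lemma additive_at_diag_offdiag P Q d o :
  peirce P Q -> P * d = d * P -> P * o + o * P = o -> additive_at d o.
Proof.
move=> pq Pd Po; have [pP _ _ _ _ _ _] := pq; have [_ PP] := pP.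
apply: additive_at_tests => w lw _.
have Pw : P * w + w * P = w.
  apply/subr0_eq/mulrn2_eq0; rewrite -mulr2n -(jstar_reflection _ pq) lw //.
  rewrite [X in additive_at _ (_ *: X)](jstar_reflection _ pq).
  by rewrite Po subrr mul0rn scaler0; apply: additive_at0r.
have Pw_comm : P * w = w * P.
  apply/subr0_eq/(scalerI imaginary_neq0).
  rewrite scaler0 -jstar_imaginary // lw //.
  rewrite [X in additive_at (_ *: X)]jstar_imaginary // Pd subrr !scaler0.
  exact: additive_at0l.
have Pw0 : P * w = 0.
  move/(congr1 ( *%R P)): Pw; rewrite -Pw_comm mulrDr mulrA PP.
  by move/(canRL (addrK _)); rewrite subrr.
by rewrite -Pw -Pw_comm Pw0 addr0.
Qed.

Lemma phi_peirce P Q a11 a12 a21 a22 : peirce P Q ->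
  corner P P a11 -> corner P Q a12 -> corner Q P a21 -> corner Q Q a22 ->
  phi ((a11 + a22) + (a12 + a21)) =
  (phi a11 + phi a22) + (phi a12 + phi a21).
Proof.
move=> pq c11 c12 c21 c22; have [pP pQ PQ QP _ _ _] := pq.
have cP := corner_projection pP.
have [[P11 P11'] [[P12 _] [_ P21]]] := (c11, (c12, c21)).
rewrite -(additive_at_diag pq c11 c22) -(additive_at_offdiag pq c12 c21).
apply: (additive_at_diag_offdiag pq).
  rewrite mulrDr mulrDl P11 P11' (corner_ortho PQ cP c22).
  by rewrite (corner_ortho QP c22 cP).
rewrite mulrDr mulrDl P12 P21 (corner_ortho PQ cP c21) (corner_ortho QP c12 cP).
by rewrite addr0 add0r.
Qed.

(** Adding [P] to [a] and [Q] to [b] makes the linear terms [a] and [b] both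
    appear in a single product, (P + a) o (Q + b) = a + b + a^* + b a^*, whose
    summands lie in three different corners apart from [a] and [b]. *)
Lemma additive_at_corner_offdiag P Q a b :
  peirce P Q -> corner P Q a -> corner P Q b -> additive_at a b.
Proof.
move=> pq ca cb.
(* The law evaluates [phi] at multiples of [r]. *)
wlog [a' ca' ->] : a ca / exists2 a', corner P Q a' & a = r *: a'.
  by apply=> //; exists (r^-1 *: a);
    [apply: cornerZ | rewrite scalerA mulfV ?scale1r].
wlog [b' cb' ->] : b cb / exists2 b', corner P Q b' & b = r *: b'.
  by apply=> //; exists (r^-1 *: b);
    [apply: cornerZ | rewrite scalerA mulfV ?scale1r].
move: a' b' ca' cb' => {ca cb a b} a b ca cb.
have [pP pQ PQ QP PQ1 _ _] := pq; have [[sP PP] [sQ QQ]] := (pP, pQ).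
have [cP cQ] := (corner_projection pP, corner_projection pQ).
have [[Pa aQ] [Pb bQ]] := (ca, cb).
have csa := corner_star sP sQ ca.
have jPQ : jstar P Q = 0 by rewrite jstar_projection // PQ QP addr0.
have jPb : jstar P b = b.
  by rewrite jstar_projection // Pb (corner_ortho QP cb cP) addr0.
have jaQ : jstar a Q = a + star a by rewrite /jstar aQ (csa.1).
have jab : jstar a b = b * star a 
  by rewrite /jstar (corner_ortho QP ca cb) add0r.
have off x : corner P Q x -> P * x + x * P = x.
  by move=> cx; rewrite (corner_ortho QP cx cP) addr0 cx.1.
have phiPa : phi (P + a) = phi P + phi a.
  by apply: (additive_at_diag_offdiag pq) => //; apply: off.
have phiQb : phi (Q + b) = phi Q + phi b.
  by apply: (additive_at_diag_offdiag pq); [rewrite PQ QP | apply: off].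
have phi_expand : phi (r *: jstar (P + a) (Q + b)) =
    (phi (r *: b) + phi (r *: (a + star a))) + phi (r *: (b * star a)).
  rewrite phi_jstar phiPa phiQb jstarDl !jstarDr (scalerDr _ (jstar _ _ + _)).
  rewrite !(scalerDr _ (jstar _ _)) -!phi_jstar jPQ jPb jaQ jab.
  by rewrite scaler0 phi0 add0r addrA.
have ccab := cornerZ r (cornerD ca cb); have ccsa := cornerZ r csa.
have ccba := cornerZ r (cornerM cb csa); have cca := cornerZ r ca.
have c0 : corner Q Q (0 : A) by split; rewrite ?mulr0 ?mul0r.
have := phi_peirce pq ccba ccab ccsa c0; rewrite phi0 !addr0.
have -> : r *: (b * star a) + (r *: (a + b) + r *: star a) =
    r *: jstar (P + a) (Q + b).
  rewrite jstarDl !jstarDr jPQ jPb jaQ jab add0r -!scalerDr; congr (_ *: _).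
  by rewrite addrC addrA; congr (_ + _); rewrite addrAC addrC addrA.
rewrite phi_expand (scalerDr r a (star a)) (additive_at_offdiag pq cca ccsa).
rewrite [RHS]addrC => /addIr; rewrite addrA => /addIr phi_ab.
by rewrite /additive_at -scalerDr -phi_ab addrC.
Qed.

(** The test [Q] annihilates both [a] and [b], which confines [w] to PAP.  The
    tests [c] of PAQ send [a] and [b] into PAQ, where additivity is known, and
    reduce to [w c = 0], since [c w^* = c (w Q)^* = 0]. *)
Lemma additive_at_corner_diag P Q a b :
  peirce P Q -> corner P P a -> corner P P b -> additive_at a b.
Proof.
move=> pq ca cb; have [pP pQ PQ QP PQ1 _ fQ] := pq.
have [[sP PP] [sQ QQ]] := (pP, pQ).
have cQ := corner_projection pQ.
apply: additive_at_tests => w lw rw.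
have Qw : Q * w + w * Q = 0.
  rewrite -jstar_projection // lw // !jstar_projection //.
  rewrite (corner_ortho QP cQ ca) [a * Q](corner_ortho PQ ca cQ) addr0 scaler0.
  exact: additive_at0l.
have QwQ : Q * w * Q = 0.
  apply: mulrn2_eq0; move/(congr1 (fun z => Q * z * Q)): Qw.
  by rewrite mulrDr mulrDl !mulrA QQ -!(mulrA _ Q Q) QQ mulr0 mul0r.
have wQ : w * Q = 0.
  by move/(congr1 ( *%R^~ Q)): Qw; rewrite mulrDl QwQ add0r -mulrA QQ mul0r.
have wP : w * P = w by rewrite -[RHS]mulr1 -PQ1 mulrDr wQ addr0.
apply: fQ => y; have cy := corner_mid y PP QQ.
have : jstar w (P * y * Q) = 0.
  apply: rw; have csa := corner_star sP sP ca; have csb := corner_star sP sP cb.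
  rewrite /jstar (corner_ortho QP cy csa) (corner_ortho QP cy csb) !addr0.
  apply: (additive_at_corner_offdiag pq); apply: cornerZ; exact: cornerM cy.
rewrite /jstar -[P * y * Q * _]mulrA -{2}sQ -starM wQ raddf0 mulr0 addr0.
by rewrite !mulrA wP.
Qed.

Lemma phi_decomposition P Q x : peirce P Q ->
  phi x = (phi (P * x * P) + phi (Q * x * Q)) +
          (phi (P * x * Q) + phi (Q * x * P)).
Proof.
move=> pq; have [[_ PP] [_ QQ] _ _ PQ1 _ _] := pq.
rewrite -(phi_peirce pq); try exact: corner_mid.
congr phi; rewrite [in RHS]addrACA -!mulrDr [Q + P]addrC PQ1.
by rewrite !mulr1 -mulrDl PQ1 mul1r.
Qed.

Lemma phi_additive P Q x y : peirce P Q -> additive_at x y.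
Proof.
move=> pq; have qp := peirce_sym pq; have [[_ PP] [_ QQ] _ _ _ _ _] := pq.
rewrite /additive_at (phi_decomposition (x + y) pq) !(mulrDr, mulrDl).
rewrite (phi_decomposition x pq) (phi_decomposition y pq).
rewrite (additive_at_corner_diag pq (corner_mid x PP PP) (corner_mid y PP PP)).
rewrite (additive_at_corner_diag qp (corner_mid x QQ QQ) (corner_mid y QQ QQ)).
rewrite (additive_at_corner_offdiag pq (corner_mid x PP QQ)
  (corner_mid y PP QQ)).
rewrite (additive_at_corner_offdiag qp (corner_mid x QQ PP)
  (corner_mid y QQ PP)).
by rewrite [RHS]addrACA; congr (_ + _); apply: addrACA.
Qed.

(** Taking [1] on the left in the law shows that [phi] commutes with the scalar
    [r]; taking [1] on the right then gives
    [phi (x + star x) = phi x + star (phi x)]. *)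
Lemma phi_star P Q x : peirce P Q -> phi 1 = 1 -> phi (star x) = star (phi x).
Proof.
move=> pq phi1.
have phiD u v : phi (u + v) = phi u + phi v := phi_additive u v pq.
have phiZ u : phi (r *: u) = r *: phi u.
  apply/subr0_eq/mulrn2_eq0; rewrite addrACA -opprD -phiD -!scalerDr -!mulr2n.
  by rewrite -jstar1l phi_jstar phi1 jstar1l subrr.
have := phi_jstar x 1; rewrite phi1 !jstar1r phiZ => /(scalerI r_neq0).
by rewrite phiD => /addrI.
Qed.

End Additivity.

Theorem theorem2p1 (R : realType) (n : nat) (hn : (2 <= n)%N)
    (A A' : cstarAlgType R) (P1 P2 : A)
    (hP2 : P2 = 1 - P1)
    (ntP1 : nontrivial_projection P1) (ntP2 : nontrivial_projection P2)
    (hfaith : forall P : A, P = P1 \/ P = P2 ->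
       forall X : A, (forall Y : A, X * Y * P = 0) -> X = 0)
    (phi : A -> A') (phi_bij : bijective phi) (phi1 : phi 1 = 1)
    (phi_qI : forall X Y : A,
       phi (qstar (nseq (n - 2) 1 ++ [:: X; Y])) =
       qstar (nseq (n - 2) (phi 1) ++ [:: phi X; phi Y]))
    (phi_qP : forall P : A, P = P1 \/ P = P2 -> forall X Y : A,
       phi (qstar (nseq (n - 2) P ++ [:: X; Y])) =
       qstar (nseq (n - 2) (phi P) ++ [:: phi X; phi Y])) :
  (forall X Y : A, phi (X + Y) = phi X + phi Y) /\
  (forall X : A, phi (star X) = star (phi X)).
Proof.
have pq : peirce P1 P2.
  case: ntP1 => pP _ _; case: ntP2 => pQ _ _; have [_ PP] := pP.
  split=> //; last by move=> x; apply: hfaith; right.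
  - by rewrite hP2 mulrBr mulr1 PP subrr.
  - by rewrite hP2 mulrBl mul1r PP subrr.
  - by rewrite hP2 addrC subrK.
  by move=> x; apply: hfaith; left.
have r_neq0 : (2 ^ (n - 2))%:R != 0 :> R[i]%C.
  by rewrite Num.Theory.pnatr_eq0 expn_eq0.
have phi_jstar x y : phi ((2 ^ (n - 2))%:R *: jstar x y) =
    (2 ^ (n - 2))%:R *: jstar (phi x) (phi y).
  by rewrite -!qstar_nseq1 phi_qI phi1.
split=> [x y | x].
  exact: (phi_additive phi_bij r_neq0 phi_jstar x y pq).
exact: (phi_star phi_bij r_neq0 phi_jstar x pq phi1).
Qed.
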